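(* Let $q$ be a prime power and $n$ a positive integer. Let $f,T\in\mathbb{F}_q[x]$ be monic divisors of $x^n-1$ with $\deg f=k$ and $\gcd\left(\frac{x^n-1}{f},T\right)\neq 1$, and let $m$ be a positive divisor of $q^n-1$. If $q^{n/2-k}\geq W(m)W(T)$, then $N_f(T,m)>0$.
   Context: For $h(x)=\sum_i a_ix^i\in\mathbb{F}_q[x]$, its linearized $q$-associate is $L_h(x)=\sum_i a_i x^{q^i}$, and $L_h(\alpha)=\sum_i a_i\alpha^{q^i}$ for $\alpha\in\mathbb{F}_{q^n}$. For a positive integer $t$, $W(t)$ is the number of square-free positive divisors of $t$; for a monic polynomial $T$, $W(T)$ is the number of square-free monic divisors of $T$ in $\mathbb{F}_q[x]$. For $m\mid q^n-1$, an element $\alpha\in\mathbb{F}_{q^n}^*$ is $m$-free if whenever $\alpha=\beta^d$ for some $\beta\in\mathbb{F}_{q^n}$ and some positive divisor $d$ of $m$, we have $d=1$ (the element $0$ is not $m$-free). For a monic divisor $M$ of $x^n-1$ in $\mathbb{F}_q[x]$, an element $\alpha\in\mathbb{F}_{q^n}$ is $M$-free if whenever $\alpha=L_h(\beta)$ for some $\beta\in\mathbb{F}_{q^n}$ and some monic divisor $h$ of $M$, we have $h=1$. For monic divisors $f,T$ of $x^n-1$ and $m\mid q^n-1$, $N_f(T,m)$ denotes the number of $T$-free elements $\alpha\in\mathbb{F}_{q^n}$ such that $L_f(\alpha)$ is $m$-free. *)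

(* Defs.v *)
From Stdlib Require Import Reals.
From HB Require Import structures.
From mathcomp Require Import all_boot all_order all_algebra all_field.
Set Implicit Arguments. Unset Strict Implicit. Unset Printing Implicit Defensive.
Import GRing.Theory.
Local Open Scope ring_scope.

(* F plays the role of F_q, L plays the role of F_{q^n} (|L| = |F|^n is a
   hypothesis of the theorem), sigma : F -> L is the embedding of F_q in F_{q^n}. *)

Definition polyT (F : finFieldType) (N : nat) (t : N.-tuple F) : {poly F} :=
  Poly (tval t).

Definition Lassoc (F L : finFieldType) (sigma : {rmorphism F -> L})
    (h : {poly F}) (a : L) : L :=
  \sum_(i < size h) sigma h`_i * a ^+ (#|F| ^ i)%N.

Definition sqfree_nat (d : nat) : bool :=
  [forall p : 'I_d.+1, (1 < (p : nat))%N ==> ~~ (p * p %| d)%N].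

Definition W_nat (t : nat) : nat :=
  #|[set d : 'I_t.+1 | (0 < (d : nat))%N && (d %| t)%N && sqfree_nat d]|.

(* square-free polynomial: no non-constant g with g^2 | p
   (any divisor of a nonzero p has size <= size p, so quantifying over
   polynomials of size <= size p is exhaustive; 0 is not square-free). *)
Definition sqfree_poly (F : finFieldType) (p : {poly F}) : bool :=
  (p != 0) &&
  [forall g : (size p).-tuple F,
     (1 < size (polyT g))%N ==> ~~ (polyT g * polyT g %| p)].

(* W(T) : number of square-free monic divisors of T in F[x].
   Divisors of T have size <= size T, and t |-> polyT t is injective on
   (size T)-tuples (coefficient i of polyT t is t_i), so counting tuples
   counts polynomials. *)
Definition W_poly (F : finFieldType) (T : {poly F}) : nat :=
  #|[set t : (size T).-tuple F |
      [&& polyT t \is monic, polyT t %| T & sqfree_poly (polyT t)]]|.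

Definition mfree (L : finFieldType) (m : nat) (a : L) : bool :=
  (a != 0) &&
  [forall d : 'I_m.+1,
     [&& (0 < (d : nat))%N, (d %| m)%N & [exists b : L, a == b ^+ d]]
       ==> ((d : nat) == 1%N)].

Definition Mfree (F L : finFieldType) (sigma : {rmorphism F -> L})
    (M : {poly F}) (a : L) : bool :=
  [forall h : (size M).-tuple F,
     [&& polyT h \is monic, polyT h %| M &
         [exists b : L, a == Lassoc sigma (polyT h) b]]
       ==> (polyT h == 1)].

Definition Nf (F L : finFieldType) (sigma : {rmorphism F -> L})
    (f T : {poly F}) (m : nat) : nat :=
  #|[set a : L | Mfree sigma T a && mfree m (Lassoc sigma f a)]|.

(* Main.v *)
(* Being T-free means avoiding the images of the maps L_P for the irreducible
   P dividing T, and being m-free means avoiding the groups of p-th powers for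
   the primes p dividing m. On the additive group of L, resp. on its unit group,
   the product of the functions 1 - 1_H over these subgroups H is expanded in
   characters. If theta is the product of the 1 - |H|/|G|, then independence of
   the subgroups makes theta the coefficient of the trivial character, while the
   absolute values of all the coefficients sum to at most theta 2^r for r
   subgroups, and 2^r is at most W(T), resp. W(m).
     It remains to bound the sums of chi(a) eta(L_f(a)) over L_f(a) <> 0. For
   eta nontrivial, expanding the condition L_f(a) = u in additive characters
   and using the Gauss sum bound gives q^(k + n/2); for eta trivial and chi
   nontrivial the sum is at most |ker L_f| <= q^k. The main term, at least
   q^n - q^k, wins. *)

Require Import Defs.
From Stdlib Require Import Reals Lra.
From HB Require Import structures.
From mathcomp Require Import all_boot all_order all_algebra all_field.
From mathcomp Require Import all_fingroup all_solvable all_character.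
From mathcomp Require Import ring zify.
Set Implicit Arguments. Unset Strict Implicit. Unset Printing Implicit Defensive.
Import Order.TTheory GRing.Theory Num.Theory.
Local Open Scope ring_scope.

(** * Sieving in a finite abelian group *)

Definition fourier_norm (gT : finGroupType) (G : {group gT})
    (phi : 'CF(G)) : algC :=
  \sum_i `|'[phi, 'chi_i]|.

Lemma fourier_norm_irr (gT : finGroupType) (G : {group gT}) (j : Iirr G) :
  fourier_norm 'chi_j = 1.
Proof.
rewrite /fourier_norm (bigD1 j) //= cfdot_irr eqxx normr1 big1 ?addr0 //.
by move=> i ji; rewrite cfdot_irr eq_sym (negPf ji) normr0.
Qed.

Lemma fourier_norm_sum (gT : finGroupType) (G : {group gT}) (I : finType)
    (a : I -> algC) (phi : I -> 'CF(G)) :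
  fourier_norm (\sum_i a i *: phi i) <= \sum_i `|a i| * fourier_norm (phi i).
Proof.
rewrite /fourier_norm; under [leRHS]eq_bigr do rewrite mulr_sumr.
rewrite exchange_big; apply: ler_sum => j _.
rewrite cfdot_suml; apply: le_trans (ler_norm_sum _ _ _) _.
by apply: ler_sum => i _; rewrite cfdotZl normrM.
Qed.

(** A product of two irreducible characters of an abelian group is again irreducible, so the
    coefficients of [phi * psi] are a convolution of those of the factors. *)
Lemma fourier_normM (gT : finGroupType) (G : {group gT}) (phi psi : 'CF(G)) :
  abelian G ->
  fourier_norm (phi * psi) <= fourier_norm phi * fourier_norm psi.
Proof.
move=> abG; have lin := char_abelianP _ abG.
rewrite {1}(cfun_sum_cfdot phi) mulr_suml.
under eq_bigr do rewrite -scalerAl.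
apply: le_trans (fourier_norm_sum _ _) _.
rewrite {2}/fourier_norm mulr_suml; apply: ler_sum => i _.
rewrite ler_wpM2l // {1}(cfun_sum_cfdot psi) mulr_sumr.
under eq_bigr do rewrite -scalerAr.
apply: le_trans (fourier_norm_sum _ _) _.
apply: ler_sum => j _.
have /irrP[k ->] : 'chi_i * 'chi_j \in irr G by rewrite mul_lin_irr ?mem_irr ?lin.
by rewrite fourier_norm_irr mulr1.
Qed.

(** ['1_H] is a multiple of the character induced from the trivial one, so its coefficients are
    nonnegative; they sum to its value 1 at the identity, and the trivial one is |H|/|G|. Hence in
    [1 - '1_H] the trivial coefficient and the absolute values of the others contribute 1 - |H|/|G|
    each. *)
Lemma fourier_norm_compl (gT : finGroupType) (G H : {group gT}) :
  abelian G -> H \subset G ->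
  fourier_norm (1 - '1_H : 'CF(G)) <= 2 * (1 - #|H|%:R / #|G|%:R).
Proof.
move=> abG sHG; have nHG : (H <| G)%g by rewrite -sub_abelian_normal.
have lin := char_abelianP _ abG.
have dot_ge0 i : 0 <= '['1_H : 'CF(G), 'chi_i].
  have iC := neq0CiG G H.
  have := cfInd_cfun1 nHG; move/(congr1 (fun phi => (#|G : H|%g)%:R^-1 *: phi)).
  rewrite scalerA mulVf // scale1r => <-; rewrite cfdotZl mulr_ge0 ?invr_ge0 //.
  by rewrite natr_ge0 // Cnat_cfdot_char ?cfInd_char ?rpred1 ?irr_char.
have dot_sum : \sum_i '['1_H : 'CF(G), 'chi_i] = 1.
  have /(congr1 (fun phi : 'CF(G) => phi 1%g)) := cfun_sum_cfdot ('1_H : 'CF(G)).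
  rewrite cfuniE // group1 sum_cfunE => e1; rewrite -[RHS]/(true%:R) e1.
  by apply: eq_bigr => i _; rewrite cfunE lin_char1 // mulr1.
have dot0 : '['1_H : 'CF(G), 'chi_0] = #|H|%:R / #|G|%:R.
  by rewrite irr0 -cfuniG cfdot_cfuni ?normal_refl // (setIidPl sHG).
rewrite /fourier_norm (bigD1 0) //= cfdotBl {1}irr0 cfnorm1 dot0.
rewrite ger0_norm; last first.
  by rewrite subr_ge0 ler_pdivrMr ?gt0CG // mul1r ler_nat subset_leq_card.
rewrite (eq_bigr (fun i => '['1_H : 'CF(G), 'chi_i])); last first.
  move=> i i0; rewrite cfdotBl -irr0 cfdot_irr eq_sym (negPf i0) sub0r normrN.
  by rewrite ger0_norm.
move: dot_sum; rewrite (bigD1 0) //= dot0 => /(canRL (addKr _)) ->.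
by rewrite [- _ + _]addrC mulrDl !mul1r.
Qed.

(* Averaging over g = h k, the shift by h is absorbed by v and the shift by k by u. *)
Lemma sum_mul_independent (gT : finGroupType) (G : {group gT})
    (u v : gT -> algC) :
  abelian G ->
  (forall g, g \in G -> exists h k, [/\ g = (h * k)%g, h \in G, k \in G,
     {in G, forall x, v (x * h)%g = v x} & {in G, forall x, u (x * k)%g = u x}]) ->
  #|G|%:R * (\sum_(x in G) u x * v x) = (\sum_(x in G) u x) * (\sum_(x in G) v x).
Proof.
move=> abG split_G.
have shift g (w : gT -> algC) : g \in G ->
  \sum_(x in G) w (x * g)%g = \sum_(x in G) w x.
  move=> Gg; rewrite [RHS](reindex_inj (mulIg g)) /=.
  by apply: eq_bigl => x; rewrite groupMr.
transitivity (\sum_(g in G) \sum_(x in G) u x * v (x * g)%g); last first.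
  rewrite exchange_big mulr_suml; apply: eq_bigr => x Gx.
  rewrite -mulr_sumr; congr (_ * _).
  rewrite -(shift _ v Gx); apply: eq_bigr => g Gg.
  by rewrite (centsP abG _ Gx _ Gg).
rewrite mulr_natl -sumr_const; apply: eq_bigr => g Gg.
have [h [k [-> Gh Gk vh uk]]] := split_G g Gg.
rewrite -(shift k (fun x => u x * v x)%R) //; apply: eq_bigr => x Gx.
by rewrite uk // (centsP abG _ Gh _ Gk) mulgA vh // groupM.
Qed.

Definition sieve (gT : finGroupType) (G : {group gT}) (I : finType)
    (H : I -> {group gT}) (s : seq I) : 'CF(G) := \prod_(i <- s) (1 - '1_(H i)).

Definition sieve_density (gT : finGroupType) (G : {group gT}) (I : finType)
    (H : I -> {group gT}) (s : seq I) : algC :=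
  \prod_(i <- s) (1 - #|H i|%:R / #|G|%:R).

(** For subgroups of an abelian [G]: each [H i] and the intersection of the others generate [G].
    Membership in the various [H i] then behaves as a family of independent events for a uniform
    element of [G]. *)
Definition independent (gT : finGroupType) (G : {group gT}) (I : finType)
    (H : I -> {group gT}) : Prop :=
  forall i g, g \in G -> exists h k, [/\ g = (h * k)%g, h \in G, k \in G,
    h \in H i & forall j, j != i -> k \in H j].

Lemma sieveE (gT : finGroupType) (G : {group gT}) (I : finType)
    (H : I -> {group gT}) (s : seq I) (x : gT) :
  abelian G -> (forall i, H i \subset G) -> x \in G ->
  sieve G H s x = (all (fun i => x \notin H i) s)%:R.
Proof.
move=> abG sHG Gx; rewrite /sieve.
elim: s => [|i s IHs]; first by rewrite big_nil cfun1E Gx.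
rewrite big_cons cfunE IHs !cfunE cfun1E Gx cfuniE -?sub_abelian_normal //=.
by case: (x \in H i); rewrite ?subrr ?mul0r // subr0 mul1r.
Qed.

Lemma fourier_norm_sieve (gT : finGroupType) (G : {group gT}) (I : finType)
    (H : I -> {group gT}) (s : seq I) :
  abelian G -> (forall i, H i \subset G) ->
  fourier_norm (sieve G H s) <= 2 ^+ size s * sieve_density G H s.
Proof.
move=> abG sHG; rewrite /sieve /sieve_density.
elim: s => [|i s IHs].
  by rewrite !big_nil expr0 mulr1 -irr0 fourier_norm_irr.
rewrite !big_cons; apply: le_trans (fourier_normM _ _ abG) _.
rewrite exprS mulrACA ler_pM ?fourier_norm_compl ?sumr_ge0 //.
Qed.

(** One subgroup is split off at a time. In g = h k the factor for [i] is unchanged by translation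
    by [h], and the product over the rest of [s], where [i] does not recur, by translation by [k];
    so the mean is multiplicative. *)
Lemma mean_sieve (gT : finGroupType) (G : {group gT}) (I : finType)
    (H : I -> {group gT}) (s : seq I) :
  abelian G -> (forall i, H i \subset G) -> independent G H -> uniq s ->
  '[sieve G H s, 1] = sieve_density G H s.
Proof.
move=> abG sHG indH; rewrite /sieve_density.
elim: s => [|i s IHs /= /andP[s_i uniq_s]].
  by rewrite /sieve !big_nil cfnorm1.
have dot1 (phi : 'CF(G)) : '[phi, 1] = #|G|%:R^-1 * \sum_(x in G) phi x.
  rewrite cfdotE; congr (_ * _); apply: eq_bigr => x Gx.
  by rewrite cfun1E Gx rmorph1 mulr1.
rewrite big_cons -IHs //.
have -> : 1 - #|H i|%:R / #|G|%:R = '[1 - '1_(H i) : 'CF(G), 1].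
  rewrite cfdotBl cfnorm1 -cfuniG.
  by rewrite cfdot_cfuni ?normal_refl -?sub_abelian_normal // (setIidPl (sHG i)).
rewrite !dot1 /sieve big_cons -/(sieve G H s).
have nz : #|G|%:R != 0 :> algC := neq0CG G.
(* Two multiplications by |G| clear the normalising factors of the scalar products. *)
apply: (mulfI nz); apply: (mulfI nz).
rewrite mulVKf // [X in _ = _ * X]mulrA mulVKf // [RHS]mulrCA mulVKf // [RHS]mulrC.
under eq_bigr do rewrite cfunE mulrC.
apply: sum_mul_independent => // g Gg.
have [h [k [-> Gh Gk Hh Hk]]] := indH i g Gg.
exists h, k; split=> // x Gx.
  by rewrite !cfunE !cfun1E !cfuniE -?sub_abelian_normal // !groupMr.
rewrite !sieveE ?groupM //; congr (_%:R); congr nat_of_bool.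
apply: eq_in_all => j sj; rewrite groupMr // Hk //.
by apply: contraNneq s_i => <-.
Qed.

(** * Character sums over a finite field *)

Lemma add_chiD (L : finFieldType) (j : Iirr [set: L]) (x y : L) :
  'chi_j (x + y) = 'chi_j x * 'chi_j y.
Proof.
have /char_abelianP/(_ j) lin := FinRing.zmod_abelian [set: L].
by rewrite -(lin_charM lin) ?inE.
Qed.

Lemma add_chi0 (L : finFieldType) (j : Iirr [set: L]) : 'chi_j (0 : L) = 1.
Proof.
have /char_abelianP/(_ j) lin := FinRing.zmod_abelian [set: L].
exact: lin_char1 lin.
Qed.

Lemma norm_add_chi (L : finFieldType) (j : Iirr [set: L]) (x : L) :
  `|'chi_j x| = 1.
Proof.
have /char_abelianP/(_ j) lin := FinRing.zmod_abelian [set: L].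
by rewrite (normC_lin_char lin) ?inE.
Qed.

Lemma add_chiN (L : finFieldType) (j : Iirr [set: L]) (x : L) :
  'chi_j (- x) = ('chi_j x)^*.
Proof.
have /char_abelianP/(_ j) lin := FinRing.zmod_abelian [set: L].
by rewrite -(lin_charV_conj lin) ?inE.
Qed.

Lemma unit_abelian (L : finFieldType) : abelian [set: {unit L}].
Proof. by apply/centsP => x _ y _; apply: val_inj; rewrite /= mulrC. Qed.

Lemma unit_chiM (L : finFieldType) (i : Iirr [set: {unit L}]) u v :
  'chi_i (u * v)%g = 'chi_i u * 'chi_i v.
Proof.
have /char_abelianP/(_ i) lin := unit_abelian L.
by rewrite -(lin_charM lin) ?inE.
Qed.

Lemma norm_unit_chi (L : finFieldType) (i : Iirr [set: {unit L}]) u :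
  `|'chi_i u| = 1.
Proof.
have /char_abelianP/(_ i) lin := unit_abelian L.
by rewrite (normC_lin_char lin) ?inE.
Qed.

Lemma sum_nontrivial_chi (gT : finGroupType) (i : Iirr [set: gT]) :
  i != 0 -> \sum_x 'chi_i x = 0.
Proof.
move=> i0; have := cfdot_irr i 0; rewrite (negPf i0) cfdotE irr0 => /eqP.
rewrite mulf_eq0 invr_eq0 (negPf (neq0CG _)) => /eqP e0.
rewrite -[RHS]e0; symmetry; apply: eq_big => [x | x _]; first by rewrite inE.
by rewrite cfun1E inE rmorph1 mulr1.
Qed.

(** If some value differs from 1, translation multiplies the sum by it and the sum vanishes;
    otherwise every term is 1. Taking [lambda] as a bare function lets it be a product of a
    character with a character composed with an additive map. *)
Lemma sum_add_morph_ge0 (L : finFieldType) (lambda : L -> algC) :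
  (forall x y, lambda (x + y) = lambda x * lambda y) ->
  0 <= \sum_x lambda x.
Proof.
move=> lamD; have [y lam_y | lam1] := pickP (fun y => lambda y != 1).
  suff -> : \sum_x lambda x = 0 by [].
  have : lambda y * \sum_x lambda x = \sum_x lambda x.
    rewrite mulr_sumr [RHS](reindex_inj (addrI y)) /=.
    by apply: eq_bigr => x _; rewrite lamD.
  move/eqP; rewrite -subr_eq0 -{2}[\sum_x _]mul1r -mulrBl mulf_eq0 subr_eq0.
  by rewrite (negPf lam_y) => /eqP.
by apply: sumr_ge0 => x _; move/negbFE/eqP: (lam1 x) => ->.
Qed.

Lemma sum_add_chi (L : finFieldType) (x y : L) :
  \sum_(j : Iirr [set: L]) 'chi_j x * ('chi_j y)^* = (#|L|%:R *+ (x == y))%R.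
Proof.
rewrite second_orthogonality_relation ?inE // -cardsT.
have abL := FinRing.zmod_abelian [set: L].
rewrite (_ : 'C_[set: L][x]%g = [set: L]); last first.
  by apply/setIidPl; rewrite sub_cent1 (subsetP abL) ?inE.
congr (_ *+ _); congr nat_of_bool; rewrite class_sym.
by rewrite (_ : x ^: _ = [set x])%g ?inE ?(eq_sym x) //;
  apply: (abelian_classP _ abL).
Qed.

Lemma sum_unit (L : finFieldType) (V : nmodType) (h : L -> V) :
  \sum_(u : {unit L}) h (val u) = \sum_(y | y != 0) h y.
Proof.
rewrite [RHS](reindex_omap (val : {unit L} -> L) insub) /=; last first.
  by move=> y y0; rewrite insubT ?unitfE.
by apply: eq_bigl => u; rewrite valK eqxx andbT -unitfE (valP u).
Qed.

(* Parseval over all dilations of the additive character: for a unit w the sums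
   twisted by w have the same modulus. *)
Lemma gauss_sum_bound (L : finFieldType) (i : Iirr [set: {unit L}])
    (j : Iirr [set: L]) :
  i != 0 -> `|\sum_u 'chi_i u * ('chi_j (val u))^*| ^+ 2 <= #|L|%:R.
Proof.
move=> i0; have [-> | j0] := eqVneq j 0.
  under eq_bigr do rewrite irr0 cfun1E inE rmorph1 mulr1.
  by rewrite sum_nontrivial_chi // normr0 expr0n ler0n.
pose Gs (y : L) := \sum_u 'chi_i u * ('chi_j (y * val u))^*.
have Gs_unit (w : {unit L}) :
    `|Gs (val w)| = `|\sum_u 'chi_i u * ('chi_j (val u))^*|.
  rewrite -[LHS]mul1r -(norm_unit_chi i w) -normrM mulr_sumr; congr `|_|.
  rewrite [RHS](reindex_inj (mulgI w)); apply: eq_bigr => u _.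
  by rewrite unit_chiM mulrA.
have Gs_sum : \sum_y `|Gs y| ^+ 2 = #|L|%:R * #|{: {unit L}}|%:R.
  (* Only the diagonal survives: for v != u the map y -> y (v - u) permutes [L], and the nontrivial
     ['chi_j] sums to 0. *)
  transitivity (\sum_(u : {unit L}) \sum_(v : {unit L}) 'chi_i u * ('chi_i v)^* *
      \sum_y 'chi_j (y * (val v - val u))).
    rewrite (eq_bigr (fun y => \sum_u \sum_v 'chi_i u * ('chi_i v)^* *
      'chi_j (y * (val v - val u)))).
      rewrite exchange_big; apply: eq_bigr => u _; rewrite exchange_big.
      by apply: eq_bigr => v _; rewrite mulr_sumr.
    move=> y _; rewrite normCK rmorph_sum mulr_suml; apply: eq_bigr => u _.
    rewrite mulr_sumr; apply: eq_bigr => v _.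
    rewrite rmorphM /= conjCK mulrBr add_chiD add_chiN.
    by rewrite [RHS]mulrA mulrACA mulrA mulrAC.
  rewrite mulr_natr -sumr_const; apply: eq_bigr => u _.
  rewrite (bigD1 u) //= [X in _ + X]big1 ?addr0 => [|v vu].
    under eq_bigr do rewrite subrr mulr0 add_chi0.
    by rewrite -normCK norm_unit_chi expr1n mul1r sumr_const.
  have vu0 : val v - val u != 0 by rewrite subr_eq0 (inj_eq val_inj).
  rewrite (_ : \sum_y _ = 0) ?mulr0 // -[RHS](sum_nontrivial_chi j0).
  by rewrite [RHS](reindex_inj (mulIf vu0)).
have U0 : 0 < #|{: {unit L}}|%:R :> algC.
  by rewrite ltr0n; apply/card_gt0P; exists 1%g.
(* The units contribute |U| equal terms to the Parseval sum, and the remaining term, at y = 0, is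
   nonnegative. *)
rewrite -(ler_pM2r U0) -Gs_sum mulr_natr -sumr_const.
rewrite (eq_bigr (fun w => `|Gs (val w)| ^+ 2)) => [|w _]; last by rewrite Gs_unit.
rewrite (sum_unit (fun y => `|Gs y| ^+ 2)) [leRHS](bigD1 0) //= lerDr.
by rewrite exprn_ge0.
Qed.

(* In effect the sum of A a * B (g a) over the a such that g a <> 0. *)
Definition pairing (L : finFieldType) (g : L -> L) (A : L -> algC)
    (B : {unit L} -> algC) : algC :=
  \sum_a \sum_u (g a == val u)%:R * (A a * B u).

(* Second orthogonality turns the condition g a = u into the average over psi
   of psi (g a) * (psi u)^*. The sums S over a are nonnegative, being sums of
   characters, so their total is read off from the kernel of g. *)
Lemma pairing_chi (L : finFieldType) (g : L -> L)
    (i : Iirr [set: {unit L}]) (j : Iirr [set: L]) :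
  {morph g : x y / x + y} -> i != 0 ->
  `|pairing g 'chi_j 'chi_i| <= #|[set x | g x == 0]|%:R * sqrtC #|L|%:R.
Proof.
move=> gD i0.
pose S k := \sum_a 'chi_j a * 'chi[[set: L]]_k (g a).
pose Gs k := \sum_u 'chi_i u * ('chi[[set: L]]_k (val u))^*.
have q0 : #|L|%:R != 0 :> algC by rewrite -cardsT neq0CG.
have q_ge0 : 0 <= #|L|%:R :> algC by rewrite ler0n.
have -> : pairing g 'chi_j 'chi_i = #|L|%:R^-1 * \sum_k S k * Gs k.
  apply: (mulfI q0); rewrite mulVKf // /pairing /S /Gs.
  under [RHS]eq_bigr => k _.
    rewrite mulr_suml; under eq_bigr do rewrite mulr_sumr; over.
  rewrite [RHS]exchange_big mulr_sumr; apply: eq_bigr => a _.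
  rewrite [RHS]exchange_big mulr_sumr; apply: eq_bigr => u _.
  under [RHS]eq_bigr do rewrite mulrACA.
  rewrite -mulr_sumr sum_add_chi; case: (g a == val u).
    by rewrite mul1r mulrC.
  by rewrite mul0r !mulr0.
have S_ge0 k : 0 <= S k.
  by apply: sum_add_morph_ge0 => x y; rewrite gD !add_chiD mulrACA.
have S_sum : \sum_k S k <= #|L|%:R * #|[set x | g x == 0]|%:R.
  have S_ker : \sum_k S k = #|L|%:R * \sum_(a in [set x | g x == 0]) 'chi_j a.
    rewrite exchange_big mulr_sumr /= [RHS]big_mkcond; apply: eq_bigr => a _.
    rewrite -mulr_sumr inE (eq_bigr (fun k => 'chi_k (g a) * ('chi_k 0)^*)).
      rewrite sum_add_chi.
      by case: (g a == 0); rewrite ?mulr0 // mulrC.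
    by move=> k _; rewrite add_chi0 rmorph1 mulr1.
  rewrite -[leLHS]ger0_norm ?sumr_ge0 // S_ker normrM ger0_norm // ler_wpM2l //.
  apply: le_trans (ler_norm_sum _ _ _) _.
  by under eq_bigr do rewrite norm_add_chi; rewrite sumr_const.
rewrite normrM ger0_norm ?invr_ge0 // ler_pdivrMl ?lt_def ?q0 //.
apply: le_trans (ler_norm_sum _ _ _) _.
apply: le_trans (_ : \sum_k S k * sqrtC #|L|%:R <= _); last first.
  by rewrite -mulr_suml mulrA ler_wpM2r ?sqrtC_ge0.
apply: ler_sum => k _; rewrite normrM ger0_norm // ler_wpM2l //.
by rewrite -ler_sqr ?nnegrE ?sqrtC_ge0 ?normr_ge0 // sqrtCK gauss_sum_bound.
Qed.

Lemma pairing_1 (L : finFieldType) (g : L -> L) (A : L -> algC) :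
  pairing g A (1 : 'CF([set: {unit L}])) = \sum_(a | g a != 0) A a.
Proof.
rewrite /pairing [RHS]big_mkcond; apply: eq_bigr => a _.
under eq_bigr do rewrite cfun1E inE mulr1.
rewrite -mulr_suml (sum_unit (fun y => (g a == y)%:R)).
have [ga0 | ga0] := eqVneq (g a) 0.
  rewrite big1 ?mul0r // => y y0; by rewrite ga0 eq_sym (negPf y0).
rewrite (bigD1 (g a)) //= eqxx big1 ?addr0 ?mul1r // => y /andP[_ y_ga].
by rewrite eq_sym (negPf y_ga).
Qed.

Lemma pairing_1_1 (L : finFieldType) (g : L -> L) :
  pairing g (1 : 'CF([set: L])) (1 : 'CF([set: {unit L}])) =
  #|L|%:R - #|[set x | g x == 0]|%:R.
Proof.
rewrite pairing_1; under eq_bigr do rewrite cfun1E inE.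
rewrite sumr_const; apply/eqP; rewrite eq_sym subr_eq -natrD addnC.
rewrite -(cardC [pred x | g x == 0]) cardsE; apply/eqP; congr (_ + _)%:R.
Qed.

(** The complete sum of ['chi_j] vanishes, so the sum off the kernel of [g] is minus the sum over
    the kernel, whose terms have modulus 1. *)
Lemma pairing_chi_1 (L : finFieldType) (g : L -> L) (j : Iirr [set: L]) :
  j != 0 ->
  `|pairing g 'chi_j (1 : 'CF([set: {unit L}]))| <= #|[set x | g x == 0]|%:R.
Proof.
move=> j0; rewrite pairing_1.
have := sum_nontrivial_chi j0.
rewrite (bigID (fun a => g a == 0)) /= => /(canRL (addKr _)) ->.
rewrite addr0 normrN; apply: le_trans (ler_norm_sum _ _ _) _.
under eq_bigr do rewrite norm_add_chi.
by rewrite sumr_const cardsE.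
Qed.

Lemma pairing_sum (L : finFieldType) (g : L -> L)
    (A : 'CF([set: L])) (B : 'CF([set: {unit L}])) :
  pairing g A B =
  \sum_j \sum_i '[A, 'chi_j] * '[B, 'chi_i] * pairing g 'chi_j 'chi_i.
Proof.
rewrite /pairing.
under [RHS]eq_bigr => j _.
  under eq_bigr do rewrite mulr_sumr.
  rewrite exchange_big.
  under eq_bigr do under eq_bigr do rewrite mulr_sumr.
  under eq_bigr do rewrite exchange_big.
  over.
rewrite [RHS]exchange_big; apply: eq_bigr => a _.
rewrite [RHS]exchange_big; apply: eq_bigr => u _.
rewrite {1}(cfun_sum_cfdot A) {1}(cfun_sum_cfdot B) !sum_cfunE.
rewrite mulr_suml mulr_sumr; apply: eq_bigr => j _.
rewrite mulr_sumr mulr_sumr; apply: eq_bigr => i _.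
by rewrite !cfunE [RHS]mulrCA; congr (_ * _); rewrite mulrACA.
Qed.

(** In the double expansion the pair (0, 0) is the main term; the pairs (j, 0) with j != 0 give the
    first error term and all pairs with i != 0 the second. Nonnegative trivial coefficients make
    each norm minus its trivial coefficient the sum over the nontrivial characters. *)
Lemma pairing_bound (L : finFieldType) (g : L -> L) (K s : algC)
    (A : 'CF([set: L])) (B : 'CF([set: {unit L}])) :
  (forall j, j != 0 ->
     `|pairing g 'chi[[set: L]]_j 'chi[[set: {unit L}]]_0| <= K) ->
  (forall j i, i != 0 ->
     `|pairing g 'chi[[set: L]]_j 'chi[[set: {unit L}]]_i| <= K * s) ->
  0 <= '[A, 'chi_0] -> 0 <= '[B, 'chi_0] ->
  `|pairing g A B - '[A, 'chi_0] * '[B, 'chi_0] *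
      pairing g 'chi[[set: L]]_0 'chi[[set: {unit L}]]_0|
    <= (fourier_norm A - '[A, 'chi_0]) * '[B, 'chi_0] * K
       + fourier_norm A * (fourier_norm B - '[B, 'chi_0]) * (K * s).
Proof.
move=> K1 K2 A0 B0.
have split_norm (gT : finGroupType) (G : {group gT}) (C : 'CF(G)) :
  0 <= '[C, 'chi_0] ->
  fourier_norm C - '[C, 'chi_0] = \sum_(i | i != 0) `|'[C, 'chi_i]|.
  by move=> C0; rewrite /fourier_norm (bigD1 0) //= ger0_norm // addrAC subrr add0r.
have -> : pairing g A B = \sum_j ('[A, 'chi_j] * '[B, 'chi_0] *
      pairing g 'chi[[set: L]]_j 'chi[[set: {unit L}]]_0 +
    \sum_(i | i != 0) '[A, 'chi_j] * '[B, 'chi_i] *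
      pairing g 'chi[[set: L]]_j 'chi[[set: {unit L}]]_i).
  by rewrite pairing_sum; apply: eq_bigr => j _; rewrite (bigD1 0).
rewrite big_split /= (bigD1 0) //= addrAC [X in X + _]addrAC subrr add0r.
apply: le_trans (ler_normD _ _) _; apply: lerD.
  rewrite split_norm // !mulr_suml; apply: le_trans (ler_norm_sum _ _ _) _.
  apply: ler_sum => j j0; rewrite 2!normrM (ger0_norm B0).
  exact: ler_wpM2l (mulr_ge0 (normr_ge0 _) B0) _ _ (K1 _ j0).
apply: le_trans (ler_norm_sum _ _ _) _.
rewrite /fourier_norm -/(fourier_norm B) split_norm // !mulr_suml.
apply: ler_sum => j _; rewrite mulr_sumr mulr_suml.
apply: le_trans (ler_norm_sum _ _ _) _.
apply: ler_sum => i i0; rewrite 2!normrM.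
exact: ler_wpM2l (mulr_ge0 (normr_ge0 _) (normr_ge0 _)) _ _ (K2 _ _ i0).
Qed.

(** The two sieves are paired along [g]. The last hypothesis is the square of k 2^|I| 2^|J| <= sqrt
    |L|, stated in the natural numbers. *)
Lemma pairing_sieve_gt0 (L : finFieldType) (g : L -> L) (k : nat)
    (I J : finType) (H : I -> {group L}) (C : J -> {group {unit L}}) :
  {morph g : x y / x + y} ->
  independent [set: L] H -> (forall i, H i \proper [set: L]) ->
  independent [set: {unit L}] C -> (forall j, C j \proper [set: {unit L}]) ->
  (#|[set x | g x == 0%R]| <= k)%N ->
  ((k * 2 ^ #|I| * 2 ^ #|J|) ^ 2 <= #|L|)%N ->
  exists a (u : {unit L}),
    [/\ g a = val u, forall i, a \notin H i & forall j, u \notin C j].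
Proof.
move=> gD indH propH indC propC ker_k kL.
pose A := sieve [set: L] H (enum I); pose B := sieve [set: {unit L}] C (enum J).
have abL := FinRing.zmod_abelian [set: L]; have abU := unit_abelian L.
have sHL i : H i \subset [set: L] by rewrite subsetT.
have sCU j : C j \subset [set: {unit L}] by rewrite subsetT.
pose x := sieve_density [set: L] H (enum I).
pose y := sieve_density [set: {unit L}] C (enum J).
have A0 : '[A, 'chi_0] = x by rewrite irr0 mean_sieve ?enum_uniq.
have B0 : '[B, 'chi_0] = y by rewrite irr0 mean_sieve ?enum_uniq.
have density_gt0 (gT : finGroupType) (G : {group gT}) (T : finType)
    (M : T -> {group gT}) r :
    (forall i, M i \proper G) -> 0 < sieve_density G M r.
  move=> propK; apply: prodr_gt0 => i _.
  by rewrite subr_gt0 ltr_pdivrMr ?gt0CG // mul1r ltr_nat proper_card.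
have x0 : 0 < x by apply: density_gt0.
have y0 : 0 < y by apply: density_gt0.
(* Each term of the pairing is 0 or 1, and it is 1 exactly at the pairs sought. *)
suff AB0 : pairing g A B != 0.
  have [a /existsP[u] | none] := pickP (fun a => [exists u : {unit L},
      [&& g a == val u, [forall i, a \notin H i] & [forall j, u \notin C j]]]).
    by case/and3P=> /eqP gau /forallP Ha /forallP Cu; exists a, u.
  case/eqP: AB0.
  rewrite /pairing big1 // => a _; rewrite big1 // => u _.
  move/existsPn/(_ u): (negbT (none a)); rewrite !sieveE ?inE //.
  have all_forall (T : finType) (p : pred T) : all p (enum T) = [forall i : T, p i].
    by apply/allP/forallP => p_ i; [apply: p_; rewrite mem_enum | move=> _].
  rewrite !all_forall; case: (g a == val u); last by rewrite mul0r.
  by do 2!case: [forall _, _]; rewrite //= ?mul0r ?mulr0.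
pose K := #|[set x | g x == 0]|%:R : algC; pose s := sqrtC #|L|%:R : algC.
have K1 j : j != 0 -> `|pairing g 'chi[[set: L]]_j 'chi[[set: {unit L}]]_0| <= K.
  by move=> j0; rewrite irr0 pairing_chi_1.
have K2 j i : i != 0 ->
    `|pairing g 'chi[[set: L]]_j 'chi[[set: {unit L}]]_i| <= K * s.
  exact: pairing_chi.
have := pairing_bound K1 K2 (A := A) (B := B).
rewrite A0 B0 => /(_ (ltW x0) (ltW y0)).
rewrite !irr0 pairing_1_1 -/K.
have := fourier_norm_sieve (enum I) abL sHL; rewrite -/A -/x.
have := fourier_norm_sieve (enum J) abU sCU; rewrite -/B -/y.
rewrite -!cardE -!natrX; set a := fourier_norm A; set b := fourier_norm B.
set w1 : algC := (2 ^ #|I|)%:R; set w2 : algC := (2 ^ #|J|)%:R => b_le a_le bnd.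
apply/negP => /eqP AB0; move: bnd; rewrite AB0 sub0r normrN => bnd.
have s2 : s ^+ 2 = #|L|%:R by rewrite sqrtCK.
have s_ge0 : 0 <= s by rewrite sqrtC_ge0 ler0n.
have K_gt0 : 0 < K.
  rewrite ltr0n; apply/card_gt0P; exists 0; rewrite inE; apply/eqP.
  by apply: (addrI (g 0)); rewrite -gD !addr0.
have w1_ge1 : 1 <= w1 by rewrite ler1n expn_gt0.
have w2_ge1 : 1 <= w2 by rewrite ler1n expn_gt0.
have w1_gt0 : 0 < w1 := lt_le_trans ltr01 w1_ge1.
have s_gt1 : 1 < s.
  rewrite -ltr_sqr ?nnegrE // s2 expr1n ltr1n; apply/card_gt1P.
  by exists 0, 1; rewrite !inE eq_sym oner_eq0.
have a_ge0 : 0 <= a by apply: sumr_ge0.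
have s_ge : K * w1 * w2 <= s.
  rewrite -ler_sqr ?nnegrE ?mulr_ge0 ?ler0n // s2 -!natrM -natrX ler_nat.
  by apply: leq_trans kL; rewrite leq_sqr !leq_mul.
(* Were the pairing zero, the main term would be at most the error. With the Fourier norms replaced
   by their bounds [w1 * x] and [w2 * y], both sides carry the positive factor [x * y]. *)
have {bnd} : x * y * (s ^+ 2 - K) <= x * y * (K * (w1 - 1) + K * s * w1 * (w2 - 1)).
  rewrite s2; apply: le_trans (real_ler_norm _) _.
    by rewrite !(rpredM, rpredB) ?realn // gtr0_real.
  apply: le_trans bnd _.
  have -> : x * y * (K * (w1 - 1) + K * s * w1 * (w2 - 1)) =
    (w1 * x - x) * y * K + w1 * x * (w2 * y - y) * (K * s) by ring.
  have Ks : 0 <= K * s by rewrite mulr_ge0 // ltW.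
  apply: lerD.
    by rewrite !ler_wpM2r ?lerD2r // ltW.
  rewrite ler_wpM2r //; apply: le_trans (_ : a * (w2 * y - y) <= _).
    by rewrite ler_wpM2l // lerD2r.
  rewrite ler_wpM2r // -[X in _ - X]mul1r -mulrBl mulr_ge0 ?subr_ge0 // ltW //.
rewrite ler_pM2l ?mulr_gt0 // => bnd.
(* Rearranged, [bnd] reads s^2 + K w1 s <= K w1 + K w1 w2 s. As K w1 w2 <= s, the right side is at
   most K w1 + s^2, which contradicts s > 1. *)
have /idP : K * w1 * s <= K * w1 * 1.
  rewrite -(lerD2r (s ^+ 2 - K * w1)).
  have -> : K * w1 * 1 + (s ^+ 2 - K * w1) = s * s by ring.
  apply: le_trans (_ : K * w1 * w2 * s <= _); last by rewrite ler_wpM2r.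
  rewrite -subr_ge0; move: bnd; rewrite -subr_ge0; congr (0 <= _); ring.
by rewrite ler_pM2l ?mulr_gt0 // lt_geF.
Qed.

(** * Linearized associates *)

Lemma pchar_nat_card (F L : finFieldType) (sigma : {rmorphism F -> L}) :
  [pchar L].-nat #|F|.
Proof.
have [p p_pr pF] := finPcharP F.
have := abelem_pgroup (fin_ring_pchar_abelem pF); rewrite /pgroup cardsT.
by apply: sub_in_pnat => r _ /eqP ->; rewrite (fmorph_pchar sigma).
Qed.

Lemma exprD_card (F L : finFieldType) (sigma : {rmorphism F -> L}) (a b : L) :
  (a + b) ^+ #|F| = a ^+ #|F| + b ^+ #|F|.
Proof. exact: exprDn_pchar (pchar_nat_card sigma). Qed.

Lemma LassocE (F L : finFieldType) (sigma : {rmorphism F -> L}) (h : {poly F})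
    (a : L) (N : nat) : (size h <= N)%N ->
  Lassoc sigma h a = \sum_(i < N) sigma h`_i * a ^+ (#|F| ^ i)%N.
Proof.
move=> hN; rewrite /Lassoc.
rewrite (big_ord_widen _ (fun i => sigma h`_i * a ^+ (#|F| ^ i)%N) hN).
rewrite big_mkcond; apply: eq_bigr => i _; case: ltnP => // h_i.
by rewrite nth_default // rmorph0 mul0r.
Qed.

Lemma LassocD (F L : finFieldType) (sigma : {rmorphism F -> L})
    (g h : {poly F}) (a : L) :
  Lassoc sigma (g + h) a = Lassoc sigma g a + Lassoc sigma h a.
Proof.
pose N := maxn (size g) (size h).
rewrite !(@LassocE _ _ _ _ _ N) ?size_polyD ?leq_maxl ?leq_maxr // -big_split /=.
by apply: eq_bigr => i _; rewrite coefD rmorphD mulrDl.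
Qed.

Lemma Lassoc_morphD (F L : finFieldType) (sigma : {rmorphism F -> L})
    (h : {poly F}) :
  {morph (Lassoc sigma h) : a b / a + b}.
Proof.
move=> a b; rewrite /Lassoc -big_split /=; apply: eq_bigr => i _.
rewrite -mulrDr; congr (_ * _).
by rewrite exprDn_pchar // pnatX pchar_nat_card.
Qed.

Lemma LassocC (F L : finFieldType) (sigma : {rmorphism F -> L}) (c : F)
    (a : L) :
  Lassoc sigma c%:P a = sigma c * a.
Proof.
rewrite (@LassocE _ _ _ _ _ 1) ?size_polyC ?leq_b1 //.
by rewrite big_ord1 coefC eqxx expn0 expr1.
Qed.

Lemma LassocMX (F L : finFieldType) (sigma : {rmorphism F -> L})
    (h : {poly F}) (a : L) :
  Lassoc sigma (h * 'X) a = Lassoc sigma h (a ^+ #|F|).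
Proof.
rewrite (@LassocE _ _ _ (h * 'X) _ (size h).+1).
  rewrite big_ord_recl coefMX eqxx rmorph0 mul0r add0r.
  by apply: eq_bigr => i _; rewrite coefMX /= expnS exprM.
by rewrite (leq_trans (size_polyMleq _ _)) // size_polyX addn2.
Qed.

Lemma LassocCM (F L : finFieldType) (sigma : {rmorphism F -> L}) (c : F)
    (h : {poly F})
    (a : L) : Lassoc sigma (c%:P * h) a = sigma c * Lassoc sigma h a.
Proof.
rewrite (@LassocE _ _ _ (c%:P * h) _ (size h)); last first.
  by rewrite mul_polyC size_scale_leq.
rewrite mulr_sumr; apply: eq_bigr => i _.
by rewrite coefCM rmorphM mulrA.
Qed.

(** The coefficients come from [F], so they are fixed by the power map of exponent |F|, which is
    additive on [L]. *)
Lemma Lassoc_card (F L : finFieldType) (sigma : {rmorphism F -> L})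
    (h : {poly F}) (a : L) :
  Lassoc sigma h (a ^+ #|F|) = Lassoc sigma h a ^+ #|F|.
Proof.
elim/poly_ind: h a => [|h c IHh] a.
  by rewrite -polyC0 !LassocC rmorph0 !mul0r expr0n (gtn_eqF (ltnW (finNzRing_gt1 F))).
rewrite !LassocD !LassocMX !LassocC (exprD_card sigma) IHh exprMn.
by rewrite -[sigma c ^+ _]rmorphXn expf_card.
Qed.

(** [L] is thus a module over F[x], with ['X] acting as the Frobenius map; divisibility of
    polynomials becomes inclusion of images. *)
Lemma LassocM (F L : finFieldType) (sigma : {rmorphism F -> L})
    (g h : {poly F}) (a : L) :
  Lassoc sigma (g * h) a = Lassoc sigma g (Lassoc sigma h a).
Proof.
elim/poly_ind: g a => [|g c IHg] a.
  by rewrite mul0r -polyC0 !LassocC rmorph0 !mul0r.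
rewrite mulrDl mulrAC !LassocD !LassocMX IHg LassocCM LassocC.
by rewrite Lassoc_card.
Qed.

(** The kernel consists of roots of the linearized polynomial [P]. The exponents q^i are distinct,
    so the coefficient of [P] at q^(deg h) is the image of the leading coefficient of [h], and [P]
    is nonzero of that degree. *)
Lemma card_ker_Lassoc (F L : finFieldType) (sigma : {rmorphism F -> L})
    (h : {poly F}) :
  h != 0 -> (#|[set a : L | Lassoc sigma h a == 0%R]| <= #|F| ^ (size h).-1)%N.
Proof.
move=> h0; have sh : (0 < size h)%N by rewrite size_poly_gt0.
pose N := (#|F| ^ (size h).-1)%N.
pose P := \sum_(i < size h) sigma h`_i *: 'X^(#|F| ^ i) : {poly L}.
have q1 : (1 < #|F|)%N by apply: finNzRing_gt1.
have P0 : P != 0.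
  apply/eqP => /(congr1 (fun p : {poly L} => p`_N)); rewrite coef0 coef_sum.
  under eq_bigr do rewrite coefZ coefXn /N eqn_exp2l //.
  have lt_p : ((size h).-1 < size h)%N by rewrite prednK.
  rewrite (bigD1 (Ordinal lt_p)) //= eqxx mulr1 big1 ?addr0 => [|i ne_i].
    by move/eqP; rewrite fmorph_eq0 -lead_coefE lead_coef_eq0 (negPf h0).
  by rewrite (_ : _ == _ = false) ?mulr0 // eq_sym; apply: negPf.
have sP : (size P <= N.+1)%N.
  apply/leq_sizeP => j N_j; rewrite coef_sum big1 // => i _.
  rewrite coefZ coefXn (_ : _ == _ = false) ?mulr0 //; apply: gtn_eqF.
  by apply: leq_ltn_trans N_j; rewrite leq_exp2l // -ltnS prednK.
rewrite -ltnS; apply: leq_trans sP; rewrite cardE.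
apply: max_poly_roots; rewrite ?enum_uniq //; apply/allP => a.
rewrite mem_enum inE /root => /eqP La0; apply/eqP; rewrite -La0 horner_sum.
by apply: eq_bigr => i _; rewrite hornerZ hornerXn.
Qed.

Lemma Lassoc_Xn_sub_1 (F L : finFieldType) (sigma : {rmorphism F -> L})
    (n : nat) (a : L) :
  #|L| = (#|F| ^ n)%N -> Lassoc sigma ('X^n - 1) a = 0.
Proof.
move=> cardL; rewrite LassocD -polyC1 -polyCN LassocC rmorphN rmorph1 mulN1r.
apply/eqP; rewrite subr_eq0; apply/eqP.
rewrite -[X in _ = X]expf_card cardL.
elim: n {cardL} a => [|n IHn] a.
  by rewrite expr0 -polyC1 LassocC rmorph1 mul1r expn0 expr1.
by rewrite exprSr LassocMX IHn -exprM -expnS.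
Qed.

Lemma Lassoc_image_group_set (F L : finFieldType) (sigma : {rmorphism F -> L})
    (h : {poly F}) :
  group_set (Lassoc sigma h @: [set: L]).
Proof.
apply/group_setP; split=> [|x y].
  apply/imsetP; exists 0; rewrite ?inE //.
  by apply: (addrI (Lassoc sigma h 0)); rewrite -Lassoc_morphD !addr0.
case/imsetP=> a _ ->; case/imsetP=> b _ ->.
by rewrite FinRing.zmodMgE -Lassoc_morphD imset_f ?inE.
Qed.

Definition Lassoc_image (F L : finFieldType) (sigma : {rmorphism F -> L})
  (h : {poly F}) : {group L} := Group (Lassoc_image_group_set sigma h).

(** If [h] acted surjectively, the cofactor (X^n - 1)/h would kill all of [L], since X^n - 1 does;
    but its kernel has at most q^(n - deg h) < q^n elements. *)
Lemma Lassoc_image_proper (F L : finFieldType) (sigma : {rmorphism F -> L})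
    (n : nat)
    (h : {poly F}) :
  (0 < n)%N -> #|L| = (#|F| ^ n)%N -> h %| 'X^n - 1 -> (1 < size h)%N ->
  Lassoc_image sigma h \proper [set: L].
Proof.
move=> n0 cardL h_n h1; rewrite properEneq subsetT andbT.
pose Xn1 : {poly F} := 'X^n - 1.
have sX : size Xn1 = n.+1 by rewrite size_XnsubC.
have X0 : Xn1 != 0 by rewrite -size_poly_gt0 sX.
have k0 : Xn1 %/ h != 0 by rewrite dvdp_div_eq0.
apply/eqP => imT; have := card_ker_Lassoc sigma k0.
have -> : [set a : L | Lassoc sigma (Xn1 %/ h) a == 0] = [set: L].
  rewrite -imT; apply/setP => a; rewrite inE.
  have /imsetP[b _ ->] : a \in Lassoc_image sigma h by rewrite imT inE.
  by rewrite -LassocM divpK // Lassoc_Xn_sub_1 // eqxx imset_f ?inE.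
rewrite cardsT cardL leq_exp2l ?finNzRing_gt1 // leqNgt => /negP; apply.
rewrite size_divp ?sX -?size_poly_gt0 ?(ltnW h1) //.
by case: (size h) h1 => [|[|d]] //= _; lia.
Qed.

Lemma coprimep_prodr (R : fieldType) (I : finType) (A : pred I)
    (P : I -> {poly R}) (g : {poly R}) :
  (forall i, A i -> coprimep g (P i)) -> coprimep g (\prod_(i | A i) P i).
Proof.
by move=> gP; elim/big_rec: _ => [|i x Ai gx]; rewrite ?coprimep1 // coprimepMr gP.
Qed.

Lemma prod_dvdp (R : fieldType) (I : finType) (A : pred I) (P : I -> {poly R})
    (g : {poly R}) :
  (forall i j, i != j -> coprimep (P i) (P j)) -> (forall i, A i -> P i %| g) ->
  \prod_(i | A i) P i %| g.
Proof.
move=> coP Pg; rewrite big_mkcond.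
have : uniq (index_enum I) by apply: index_enum_uniq.
elim: (index_enum I) => [|i s IHs /= /andP[s_i uniq_s]]; first by rewrite big_nil dvd1p.
rewrite big_cons; case: ifP => Ai; last by rewrite mul1r IHs.
rewrite Gauss_dvdp ?Pg ?IHs //.
rewrite big_seq; elim/big_rec: _ => [|j x sj ix]; first exact: coprimep1.
rewrite coprimepMr ix andbT; case: ifP => _; last exact: coprimep1.
by apply: coP; apply: contraNneq s_i => ->.
Qed.

(** A Bezout relation P_i u + Q v = 1, with Q the product of the other P_j, acts on [g] and splits
    it into the two required summands. *)
Lemma independent_Lassoc_image (F L : finFieldType) (sigma : {rmorphism F -> L})
    (I : finType) (P : I -> {poly F}) :
  (forall i j, i != j -> coprimep (P i) (P j)) ->
  independent [set: L] (fun i => Lassoc_image sigma (P i)).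
Proof.
move=> coP i g _; pose Q := \prod_(j | j != i) P j.
have /Bezout_eq1_coprimepP[[u v] /= uv1] : coprimep (P i) Q.
  by apply: coprimep_prodr => j ji; apply: coP; rewrite eq_sym.
exists (Lassoc sigma (P i * u) g), (Lassoc sigma (Q * v) g).
rewrite !inE; split=> //.
- rewrite FinRing.zmodMgE -LassocD mulrC [Q * v]mulrC uv1.
  by rewrite -polyC1 LassocC rmorph1 mul1r.
- by rewrite LassocM imset_f ?inE.
by move=> j ji; rewrite /Q (bigD1 j) //= -mulrA LassocM imset_f ?inE.
Qed.

(** * Monic irreducible divisors *)

Definition tuple_of_poly (F : finFieldType) (N : nat)
    (p : {poly F}) : N.-tuple F :=
  [tuple p`_i | i < N].

Lemma tuple_of_polyK (F : finFieldType) (N : nat) (p : {poly F}) :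
  (size p <= N)%N -> polyT (tuple_of_poly N p) = p.
Proof.
move=> pN; apply/polyP => i; rewrite coef_Poly.
have [iN | Ni] := ltnP i N; last by rewrite !nth_default ?size_tuple // (leq_trans pN).
by rewrite -[i]/(nat_of_ord (Ordinal iN)) -tnth_nth tnth_mktuple.
Qed.

Lemma polyT_inj (F : finFieldType) (N : nat) : injective (@polyT F N).
Proof.
move=> s t /(congr1 (fun p : {poly F} => polyseq p)) st; apply: eq_from_tnth => i.
have /(congr1 (fun p => p`_i)) := st.
by rewrite !coef_Poly -!tnth_nth.
Qed.

Lemma dvdp_size_monic (F : finFieldType) (T p : {poly F}) :
  T \is monic -> p %| T -> (size p <= size T)%N.
Proof. by move=> mT; apply: dvdp_leq; apply: monic_neq0. Qed.

(* The tuple t encodes a monic irreducible divisor of T; irreducibility is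
   phrased as minimality among the nonconstant monic polynomials dividing it. *)
Definition irred_divisor (F : finFieldType) (T : {poly F})
    (t : (size T).-tuple F) : bool :=
  [&& polyT t \is monic, (1 < size (polyT t))%N, polyT t %| T &
   [forall g : (size T).-tuple F,
     [&& polyT g \is monic, (1 < size (polyT g))%N & polyT g %| polyT t] ==> (g == t)]].

Definition irred_index (F : finFieldType) (T : {poly F}) : finType :=
  {t : (size T).-tuple F | irred_divisor t}.

Definition irred_factor (F : finFieldType) (T : {poly F})
    (i : irred_index T) : {poly F} :=
  polyT (val i).

Lemma irred_factor_monic (F : finFieldType) (T : {poly F}) (i : irred_index T) :
  irred_factor i \is monic.
Proof. by case/and4P: (valP i). Qed.

Lemma irred_factor_size (F : finFieldType) (T : {poly F}) (i : irred_index T) :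
  (1 < size (irred_factor i))%N.
Proof. by case/and4P: (valP i). Qed.

Lemma irred_factor_dvd (F : finFieldType) (T : {poly F}) (i : irred_index T) :
  irred_factor i %| T.
Proof. by case/and4P: (valP i). Qed.

Lemma irred_factor_min (F : finFieldType) (T g : {poly F}) (i : irred_index T) :
  T \is monic -> g \is monic -> (1 < size g)%N -> g %| irred_factor i ->
  g = irred_factor i.
Proof.
move=> mT mg g1 gi; case/and4P: (valP i) => _ _ iT /forallP/(_ (tuple_of_poly _ g)).
have gT := dvdp_trans gi iT.
rewrite tuple_of_polyK ?dvdp_size_monic // mg g1 gi /= => /eqP e.
by rewrite -(tuple_of_polyK (dvdp_size_monic mT gT)) e.
Qed.

Lemma scale_monic (F : fieldType) (p : {poly F}) :
  p != 0 -> ((lead_coef p)^-1 *: p \is monic) * ((lead_coef p)^-1 *: p %= p).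
Proof.
move=> p0; have lc0 : lead_coef p != 0 by rewrite lead_coef_eq0.
by rewrite eqp_scale ?invr_eq0 // monicE lead_coefZ mulVf.
Qed.

(** A nonconstant gcd, made monic, would by minimality equal both factors. *)
Lemma irred_factor_coprime (F : finFieldType) (T : {poly F})
    (i j : irred_index T) :
  T \is monic -> i != j -> coprimep (irred_factor i) (irred_factor j).
Proof.
move=> mT; apply: contraNT => nco.
pose d := gcdp (irred_factor i) (irred_factor j).
have d0 : d != 0 by rewrite gcdp_eq0 negb_and (monic_neq0 (irred_factor_monic i)).
have [md ed] := scale_monic d0; set e := _ *: d in md ed.
have e1 : (1 < size e)%N.
  rewrite (eqp_size ed) ltn_neqAle eq_sym size_poly_gt0 d0 andbT.
  by apply: contra nco; rewrite /coprimep eq_sym.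
have ei : e = irred_factor i.
  by apply: irred_factor_min; rewrite ?(eqp_dvdl _ ed) ?dvdp_gcdl.
have ej : e = irred_factor j.
  by apply: irred_factor_min; rewrite ?(eqp_dvdl _ ed) ?dvdp_gcdr.
by apply/eqP/val_inj/polyT_inj; rewrite -/(irred_factor i) -ei ej.
Qed.

(** Induction on a bound for the size: if the monic multiple of [h] is not minimal, it has a
    strictly smaller nonconstant monic divisor. *)
Lemma irred_factor_exists (F : finFieldType) (T h : {poly F}) :
  T \is monic -> h %| T -> (1 < size h)%N ->
  exists i : irred_index T, irred_factor i %| h.
Proof.
move=> mT; elim: (size h) {-2}h (leqnn (size h)) => {h} [|s IHs] h hs hT h1.
  by move: (leq_trans h1 hs).
have h0 : h != 0 by rewrite -size_poly_gt0 ltnW.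
have [me ee] := scale_monic h0; set e := _ *: h in me ee.
have e1 : (1 < size e)%N by rewrite (eqp_size ee).
have eT : e %| T by rewrite (eqp_dvdl _ ee).
have [irr_e | ] := boolP (irred_divisor (tuple_of_poly (size T) e)).
  exists (exist (fun t : (size T).-tuple F => irred_divisor t) _ irr_e).
  by rewrite /irred_factor /= tuple_of_polyK ?dvdp_size_monic // (eqp_dvdl _ ee).
rewrite /irred_divisor tuple_of_polyK ?dvdp_size_monic // me e1 eT /=.
case/forallPn => g; rewrite negb_imply => /andP[/and3P[mg g1 ge] g_e].
have gh : polyT g %| h by rewrite -(eqp_dvdr _ ee).
have [|i ig] := IHs (polyT g) _ (dvdp_trans gh hT) g1; last first.
- by exists i; apply: dvdp_trans gh.
rewrite -ltnS; apply: leq_trans hs; rewrite -(eqp_size ee).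
rewrite ltn_neqAle dvdp_leq ?monic_neq0 // andbT dvdp_size_eqp // eqp_monic //.
apply: contra g_e => /eqP ge'; apply/eqP/polyT_inj.
by rewrite tuple_of_polyK ?dvdp_size_monic.
Qed.

(** Recovers [D] from its product, which gives injectivity in the count of square-free divisors. *)
Lemma irred_factor_dvd_prod (F : finFieldType) (T : {poly F})
    (D : {set irred_index T}) i :
  T \is monic -> (irred_factor i %| \prod_(j in D) irred_factor j) = (i \in D).
Proof.
move=> mT; have [iD | iD] := boolP (i \in D); first by rewrite (bigD1 i) ?dvdp_mulr.
apply: contraTF (irred_factor_size i) => iprod; rewrite -leqNgt.
have co : coprimep (irred_factor i) (\prod_(j in D) irred_factor j).
  apply: coprimep_prodr => j Dj; apply: irred_factor_coprime => //.
  by apply: contraNneq iD => ->.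
by move: co; rewrite /coprimep (eqp_size (dvdp_gcd_idl iprod)) => /eqP ->.
Qed.

(** Distinct sets of irreducible factors have distinct products, all dividing [T]. Such a product is
    square-free: a repeated factor would contain some P_i twice, and cancelling one copy leaves P_i
    dividing the product over the set without i. *)
Lemma irred_index_W_poly (F : finFieldType) (T : {poly F}) :
  T \is monic -> (2 ^ #|irred_index T| <= W_poly T)%N.
Proof.
move=> mT; pose Q (D : {set irred_index T}) := \prod_(j in D) irred_factor j.
have mQ D : Q D \is monic by apply: monic_prod => i _; apply: irred_factor_monic.
have QT D : Q D %| T.
  apply: prod_dvdp => [i j ij|i _]; first exact: irred_factor_coprime.
  exact: irred_factor_dvd.
have QK D : polyT (tuple_of_poly (size T) (Q D)) = Q D.
  by rewrite tuple_of_polyK ?dvdp_size_monic.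
have injQ : injective (fun D => tuple_of_poly (size T) (Q D)).
  move=> D E /(congr1 (@polyT _ _)); rewrite !QK => DE.
  by apply/setP => i; rewrite -!(irred_factor_dvd_prod _ i mT) -/(Q D) DE.
have <- : #|{set irred_index T}| = (2 ^ #|irred_index T|)%N.
  by rewrite -[LHS]cardsT -powersetT card_powerset cardsT.
rewrite -cardsT -(card_imset _ injQ) subset_leq_card //.
apply/subsetP => _ /imsetP[D _ ->]; rewrite inE QK mQ QT /= /sqfree_poly.
rewrite monic_neq0 //=; apply/forallP => g; apply/implyP => g1; apply/negP => ggD.
have gD : polyT g %| Q D by apply: dvdp_trans ggD; apply: dvdp_mulr.
have [i ig] := irred_factor_exists mT (dvdp_trans gD (QT D)) g1.
have iD : i \in D by rewrite -(irred_factor_dvd_prod _ i mT) (dvdp_trans ig).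
have := dvdp_trans (dvdp_mul ig ig) ggD; rewrite /Q (big_setD1 i) //=.
rewrite dvdp_mul2l ?monic_neq0 ?irred_factor_monic //.
by rewrite irred_factor_dvd_prod // !inE eqxx.
Qed.

(** A monic divisor [h] other than 1 is nonconstant, so some P_i divides it, and the image of L_h
    lies in that of L_(P_i). *)
Lemma Mfree_irred (F L : finFieldType) (sigma : {rmorphism F -> L})
    (T : {poly F}) (a : L) :
  T \is monic -> (forall i : irred_index T, a \notin Lassoc_image sigma (irred_factor i)) ->
  Mfree sigma T a.
Proof.
move=> mT a_free; apply/forallP => h; apply/implyP => /and3P[mh hT /existsP[b /eqP ab]].
apply: contraT => h_neq1.
have h1 : (1 < size (polyT h))%N.
  rewrite ltnNge; apply: contra h_neq1 => /size1_polyC hc; move: mh.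
  by rewrite hc monicE lead_coefC => /eqP ->.
have [i /dvdpP[R hR]] := irred_factor_exists mT hT h1.
case/negP: (a_free i); rewrite ab hR mulrC LassocM; apply: imset_f.
by rewrite inE.
Qed.

(** * Prime divisors and powers in the unit group *)

Definition prime_index (m : nat) : finType :=
  {p : 'I_m.+1 | prime p && (p %| m)%N}.

Definition prime_factor (m : nat) (i : prime_index m) : nat := val (val i).

Lemma prime_factor_prime (m : nat) (i : prime_index m) : prime (prime_factor i).
Proof. by case/andP: (valP i). Qed.

Lemma prime_factor_dvd (m : nat) (i : prime_index m) : (prime_factor i %| m)%N.
Proof. by case/andP: (valP i). Qed.

Lemma prime_factor_exists (m d : nat) :
  (0 < m)%N -> (d %| m)%N -> d != 1%N -> exists i : prime_index m, (prime_factor i %| d)%N.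
Proof.
move=> m0 dm d1.
have d0 : (0 < d)%N := dvdn_gt0 m0 dm.
have p_pr : prime (pdiv d) by rewrite pdiv_prime // ltn_neqAle eq_sym d1.
have pm : (pdiv d %| m)%N := dvdn_trans (pdiv_dvd d) dm.
have lt_pm : (pdiv d < m.+1)%N by rewrite ltnS dvdn_leq.
have ok : prime (Ordinal lt_pm) && (Ordinal lt_pm %| m)%N by rewrite p_pr.
exists (exist (fun p : 'I_m.+1 => prime p && (p %| m)%N) _ ok).
exact: pdiv_dvd.
Qed.

Lemma prime_factor_coprime (m : nat) (i j : prime_index m) :
  i != j -> coprime (prime_factor i) (prime_factor j).
Proof.
move=> ij; rewrite prime_coprime ?prime_factor_prime //.
rewrite dvdn_prime2 ?prime_factor_prime //.
Qed.

Lemma prime_factor_coprime_prod (m : nat) (A : pred (prime_index m))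
    (i : prime_index m) :
  ~~ A i -> coprime (prime_factor i) (\prod_(j | A j) prime_factor j)%N.
Proof.
move=> nAi; elim/big_rec: _ => [|j x Aj ix]; first exact: coprimen1.
rewrite coprimeMr ix andbT prime_factor_coprime //.
by apply: contraNneq nAi => ->.
Qed.

Lemma prime_factor_prod_dvd (m : nat) (A : pred (prime_index m)) :
  (\prod_(j | A j) prime_factor j %| m)%N.
Proof.
rewrite big_mkcond.
have : uniq (index_enum (prime_index m)) by apply: index_enum_uniq.
elim: (index_enum _) => [|i s IHs /= /andP[s_i uniq_s]]; first by rewrite big_nil dvd1n.
rewrite big_cons; case: ifP => Ai; last by rewrite mul1n IHs.
rewrite Gauss_dvd ?prime_factor_dvd ?IHs //.
rewrite big_seq; elim/big_rec: _ => [|j x sj ix]; first exact: coprimen1.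
rewrite coprimeMr ix andbT; case: ifP => _; last exact: coprimen1.
by apply: prime_factor_coprime; apply: contraNneq s_i => ->.
Qed.

Lemma prime_factor_dvd_prod (m : nat) (D : {set prime_index m}) i :
  (prime_factor i %| \prod_(j in D) prime_factor j)%N = (i \in D).
Proof.
have [iD | iD] := boolP (i \in D); first by rewrite (bigD1 i) ?dvdn_mulr.
have := prime_factor_coprime_prod iD.
by rewrite prime_coprime ?prime_factor_prime // => /negPf.
Qed.

Lemma prime_index_W_nat (m : nat) : (0 < m)%N ->
    (2 ^ #|prime_index m| <= W_nat m)%N.
Proof.
move=> m0; pose Q (D : {set prime_index m}) := (\prod_(j in D) prime_factor j)%N.
have Qm D : (Q D %| m)%N by apply: prime_factor_prod_dvd.
(* [inord] falls back to 0 out of range; here [Q D] divides the positive [m], so it is at most [m]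
   and nothing is lost. *)
have QK D : (inord (Q D) : 'I_m.+1) = Q D :> nat by rewrite inordK // ltnS dvdn_leq.
have injQ : injective (fun D => inord (Q D) : 'I_m.+1).
  move=> D E /(congr1 (@nat_of_ord _)); rewrite !QK => DE.
  by apply/setP => i; rewrite -!(prime_factor_dvd_prod _ i) -/(Q D) DE.
have <- : #|{set prime_index m}| = (2 ^ #|prime_index m|)%N.
  by rewrite -[LHS]cardsT -powersetT card_powerset cardsT.
rewrite -cardsT -(card_imset _ injQ) subset_leq_card //.
apply/subsetP => _ /imsetP[D _ ->]; rewrite inE QK Qm (dvdn_gt0 m0 (Qm D)) /=.
apply/forallP => g; apply/implyP => g1; apply/negP => ggD.
have gD : (g %| Q D)%N by apply: dvdn_trans ggD; apply: dvdn_mulr.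
have [||i ig] := @prime_factor_exists m g m0; first exact: dvdn_trans (Qm D).
  by rewrite gtn_eqF.
have iD : i \in D by rewrite -(prime_factor_dvd_prod _ i) (dvdn_trans ig).
have := dvdn_trans (dvdn_mul ig ig) ggD; rewrite /Q (big_setD1 i) //=.
rewrite dvdn_pmul2l ?prime_gt0 ?prime_factor_prime //.
by rewrite prime_factor_dvd_prod // !inE eqxx.
Qed.

Lemma powers_group_set (L : finFieldType) (d : nat) :
  group_set [set (u ^+ d)%g | u in [set: {unit L}]].
Proof.
apply/group_setP; split=> [|x y].
  by apply/imsetP; exists 1%g; rewrite ?inE ?expg1n.
case/imsetP=> a _ ->; case/imsetP=> b _ ->; rewrite -expgMn.
  by apply: imset_f; rewrite inE.
by apply: (centsP (unit_abelian L)); rewrite inE.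
Qed.

Definition powers (L : finFieldType) (d : nat) : {group {unit L}} :=
  Group (powers_group_set L d).

(* Otherwise 'X^((|L| - 1) / d) - 1 has |L| - 1 roots. *)
Lemma powers_proper (L : finFieldType) (d : nat) :
  (1 < d)%N -> (d %| #|L| - 1)%N -> powers L d \proper [set: {unit L}].
Proof.
move=> d1 dL; rewrite properEneq subsetT andbT; apply/eqP => powT.
have L1 : (0 < #|L| - 1)%N by rewrite subn_gt0 finNzRing_gt1.
have e0 : (0 < (#|L| - 1) %/ d)%N by rewrite divn_gt0; [exact: dvdn_leq | exact: ltnW].
have cardU : #|{: {unit L}}| = (#|L| - 1)%N by rewrite -cardsT card_finField_unit subn1.
have : (#|{: {unit L}}| <= (#|L| - 1) %/ d)%N.
  rewrite cardE -(size_map val); apply: (max_unity_roots (F := L)) => //; last first.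
    by rewrite (map_inj_uniq val_inj) enum_uniq.
  apply/allP => _ /mapP[u _ ->]; apply/unity_rootP.
  have /imsetP[v _ ->] : u \in powers L d by rewrite powT inE.
  rewrite FinRing.val_unitX -exprM mulnC divnK // -cardU -cardsT -FinRing.val_unitX.
  by rewrite expg_cardG ?inE.
by rewrite cardU leqNgt ltn_Pdiv.
Qed.

(** Bezout over the naturals reads a p_i = b Q + 1, with Q the product of the other primes, so g is
    g^(a p_i) times the power b Q of [g^-1]. *)
Lemma independent_powers (L : finFieldType) (m : nat) :
  independent [set: {unit L}] (fun i : prime_index m => powers L (prime_factor i)).
Proof.
move=> i g _; pose Q := (\prod_(j | j != i) prime_factor j)%N.
have co : coprime (prime_factor i) Q by apply: prime_factor_coprime_prod; rewrite negbK.
have [a b ab _] := egcdnP Q (prime_gt0 (prime_factor_prime i)).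
exists (g ^+ (a * prime_factor i))%g, (g^-1 ^+ (b * Q))%g; rewrite !inE; split=> //.
- by rewrite ab (eqP co) expgVn addn1 expgS mulgK.
- by apply/imsetP; exists (g ^+ a)%g; rewrite ?inE ?expgM.
move=> j ji; apply/imsetP; rewrite /Q (bigD1 j) //= mulnCA mulnC expgM.
by eexists; last reflexivity; rewrite inE.
Qed.

Lemma mfree_powers (L : finFieldType) (m : nat) (u : {unit L}) :
  (0 < m)%N -> (forall i : prime_index m, u \notin powers L (prime_factor i)) ->
  mfree m (val u).
Proof.
move=> m0 u_free; rewrite /mfree -unitfE (valP u) /=.
apply/forallP => d; apply/implyP => /and3P[d0 dm /existsP[b /eqP ub]].
apply: contraT => d1; have [i id] := prime_factor_exists m0 dm d1.
case/negP: (u_free i).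
(* [mfree] allows any base in [L]; a base whose power of positive exponent is a unit is itself a
   unit, so [u] is a p-th power inside the unit group. *)
have Ub : b \is a GRing.unit by rewrite -(unitrX_pos _ d0) -ub (valP u).
apply/imsetP; exists (FinRing.unit L Ub ^+ (d %/ prime_factor i))%g; first by rewrite inE.
by apply: val_inj; rewrite -expgM divnK // FinRing.val_unitX.
Qed.

(** * Conclusion *)

Lemma INR_expn (a b : nat) : INR (a ^ b)%N = pow (INR a) b.
Proof. by elim: b => // b IHb; rewrite expnS mult_INR IHb. Qed.

(** Squaring removes the half-integral exponent: q^k times q^(n/2 - k) squares to q^n, which turns
    the real hypothesis into one on naturals. *)
Lemma Rpower_half_bound (q n k w : nat) : (0 < q)%N ->
  Rge (Rpower (INR q) (Rminus (Rdiv (INR n) (INR 2)) (INR k))) (INR w) ->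
  ((q ^ k * w) ^ 2 <= q ^ n)%N.
Proof.
move=> q0; set x := Rpower _ _ => xw.
have q0R : Rlt 0 (INR q) by apply/lt_0_INR/ssrnat.ltP.
have sq : Rmult (Rmult (pow (INR q) k) x) (Rmult (pow (INR q) k) x) = pow (INR q) n.
  rewrite -!Rpower_pow // /x -!Rpower_plus; congr Rpower.
  rewrite /Rdiv /=; lra.
have w0 : Rle 0 (INR w) by apply: pos_INR.
have qk0 : Rlt 0 (pow (INR q) k) by apply: pow_lt.
apply/ssrnat.leP/INR_le; rewrite !INR_expn mult_INR INR_expn -sq /= Rmult_1_r.
have le : Rle (Rmult (pow (INR q) k) (INR w)) (Rmult (pow (INR q) k) x).
  by apply: Rmult_le_compat_l; lra.
have ge0 : Rle 0 (Rmult (pow (INR q) k) (INR w)) by apply: Rmult_le_pos; lra.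
exact: Rmult_le_compat.
Qed.

Theorem theorem4p2 (F L : finFieldType) (sigma : {rmorphism F -> L})
    (n k m : nat) (f T : {poly F}) :
  (0 < n)%N ->
  #|L| = (#|F| ^ n)%N ->
  f \is monic -> f %| 'X^n - 1 ->
  T \is monic -> T %| 'X^n - 1 ->
  (size f).-1 = k ->
  ~~ coprimep (('X^n - 1) %/ f) T ->
  (0 < m)%N -> (m %| #|F| ^ n - 1)%N ->
  Rge (Rpower (INR #|F|) (Rminus (Rdiv (INR n) (INR 2)) (INR k)))
      (INR (W_nat m * W_poly T)) ->
  (0 < Nf sigma f T m)%N.
Proof.
move=> n0 cardL mf _ mT Tn <- _ m0 mq bound.
have q0 : (0 < #|F|)%N := ltnW (finNzRing_gt1 F).
(* The sieve is run with [g] equal to L_f, whose kernel has at most q^(deg f) elements. *)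
have [|||||||a [u [fau a_free u_free]]] := @pairing_sieve_gt0 L (Lassoc sigma f)
  (#|F| ^ (size f).-1)%N (irred_index T) (prime_index m)
  (fun i => Lassoc_image sigma (irred_factor i)) (fun i => powers L (prime_factor i)).
- exact: Lassoc_morphD.
- by apply: independent_Lassoc_image => i j; apply: irred_factor_coprime.
- move=> i; apply: Lassoc_image_proper n0 cardL _ _.
    exact: dvdp_trans (irred_factor_dvd i) Tn.
  exact: irred_factor_size.
- exact: independent_powers.
- move=> i; apply: powers_proper; first exact: prime_gt1 (prime_factor_prime i).
  by rewrite cardL (dvdn_trans (prime_factor_dvd i)).
- exact: card_ker_Lassoc (monic_neq0 mf).
(* The powers of 2 counting subsets of irreducible and of prime factors are bounded by W(T) and
   W(m). *)
- rewrite cardL; apply: leq_trans (Rpower_half_bound q0 bound).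
  rewrite leq_sqr -mulnA leq_mul // mulnC leq_mul ?prime_index_W_nat //.
  exact: irred_index_W_poly.
apply/card_gt0P; exists a; rewrite inE Mfree_irred //= fau.
exact: mfree_powers.
Qed.
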